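(* Let $l \geq 1$ be an integer. The reduction algorithm started from $X(l)$ terminates after finitely many cycles. Moreover, in each cycle the output sequence $W$ is a translate of $X(j)$ for some integer $0 \leq j < l$, i.e. $W = X(j) + \mathbf{t}$ for some constant sequence $\mathbf{t} = (t,t,t,\dots)$.
   Context: For integers $m \geq 1$ and $0 \leq l \leq m$ let $A_{l,m} = \frac{l!\, m!}{2^{m-l}} \sum_{k=l}^{m} 2^{k} \binom{2m-2k}{m-k}\binom{m+k}{m}\binom{k}{l}$ (integers; $A_{0,0}=1$), and let $\nu_2$ denote the $2$-adic valuation. For $l \geq 0$ let $X(l) = \big(\nu_2(A_{l,\,l+m-1})\big)_{m \geq 1}$ (so $X(0)$ is the zero sequence). Operators on sequences: $F(a_1,a_2,a_3,\dots) = (a_1,a_1,a_2,a_3,\dots)$, $T(a_1,a_2,a_3,\dots) = (a_1,a_3,a_5,\dots)$. Let $c = (\nu_2(m))_{m\geq 1}$. For $s \geq 2$, a sequence $(a_j)_{j\geq1}$ is $s$-simple if $s$ is the largest integer with $a_{st+1} = \cdots = a_{s(t+1)}$ for all $t \geq 0$. Reduction algorithm: $X_1(l) = X(l)$; at cycle $k$, take $n_k$ with $X_k(l)$ $2^{n_k}$-simple, set $Y = T^{n_k}(X_k(l))$, $Z = Y - c$ (termwise), $W = F(Z)$; if $W$ is constant stop, otherwise set $X_{k+1}(l) = W$ and continue. *)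

(* Defs.v *)
From mathcomp Require Import all_boot all_order all_algebra.

Set Implicit Arguments.
Unset Strict Implicit.
Unset Printing Implicit Defensive.

Import Order.TTheory GRing.Theory Num.Theory.
Local Open Scope ring_scope.

(* The coefficients are integers, but they are written with a division by
   [2 ^ (m - l)]; they are kept in [rat] so that the quotient is exact. *)
Definition A (l m : nat) : rat :=
  (l`! * m`!)%:R / 2 ^+ (m - l)
  * \sum_(l <= k < m.+1)
      (2 ^ k * 'C(2 * m - 2 * k, m - k) * 'C(m + k, m) * 'C(k, l))%:R.

(* 2-adic valuation on the rationals, with the junk value [nu2 0 = 0]. *)
Definition nu2 (x : rat) : int :=
  (logn 2 `|numq x|%N)%:Z - (logn 2 `|denq x|%N)%:Z.

(* The sequence (a_1, a_2, a_3, ...) is represented by [a : nat -> int] with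
   [a i] standing for a_{i+1}. The values may be negative since the algorithm
   subtracts [c]. *)
Definition sequence := nat -> int.

Definition X (l : nat) : sequence := fun i => nu2 (A l (l + i)).

Definition F (a : sequence) : sequence := fun i => a i.-1.

Definition T (a : sequence) : sequence := fun i => a (2 * i)%N.

Definition c : sequence := fun i => nu2 i.+1%:R.

Definition constant_seq (a : sequence) : Prop := exists t, forall i, a i = t.

Definition block_constant (s : nat) (a : sequence) : Prop :=
  forall t i, (i < s)%N -> a (s * t + i)%N = a (s * t)%N.

Definition simple (s : nat) (a : sequence) : Prop :=
  [/\ (2 <= s)%N, block_constant s a
    & forall s', block_constant s' a -> (s' <= s)%N].

Definition output (n : nat) (a : sequence) : sequence :=
  let Y := iter n T a in
  let Z : sequence := fun i => Y i - c i in
  F Z.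

(* [algo_cycle l k a w]: the reduction algorithm started from [X l] performs a k-th
   cycle, whose input is [a] and whose output is [w]. *)
Inductive algo_cycle (l : nat) : nat -> sequence -> sequence -> Prop :=
| algo_cycle_first n : simple (2 ^ n)%N (X l) -> algo_cycle l 1 (X l) (output n (X l))
| algo_cycle_next k a w n : algo_cycle l k a w -> ~ constant_seq w ->
    simple (2 ^ n)%N w -> algo_cycle l k.+1 w (output n w).

Lemma simple_uniq (s s' : nat) (a : sequence) :
  simple s a -> simple s' a -> s = s'.
Proof.
move=> [_ bs maxs] [_ bs' maxs']; apply/eqP.
by rewrite eqn_leq maxs' ?maxs.
Qed.

(* The algorithm is deterministic, so one finite run ending in a constant output
   is the whole execution. *)
Lemma algo_cycle_functional (l k : nat) (a w a' w' : sequence) :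
  algo_cycle l k a w -> algo_cycle l k a' w' -> a = a' /\ w = w'.
Proof.
have n_uniq n n' b : simple (2 ^ n)%N b -> simple (2 ^ n')%N b -> n = n'.
  by move=> sn sn'; apply: (@expnI 2 isT); apply: (simple_uniq sn sn').
move=> h; elim: h a' w' => {k a w} [n sn|k a w n h IH nc sn] a' w' h'.
  inversion h' as [n' sn' | k0 a0 w0 n' h0].
    by rewrite (n_uniq _ _ _ sn sn').
  by inversion h0.
inversion h' as [n' sn' e1 | k0 a0 w0 n' h0 nc0 sn' e1]; subst.
  by inversion h.
have [_ e] := IH _ _ h0; rewrite -e in sn' *.
by rewrite (n_uniq _ _ _ sn sn').
Qed.

Definition terminates (l : nat) : Prop :=
  exists k a w, algo_cycle l k a w /\ constant_seq w.

Definition is_translate (w b : sequence) : Prop :=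
  exists t : int, forall i, w i = b i + t.

(* Main.v *)
(** The generating polynomial of [A_{l,m}] is hypergeometric, which gives a
    three-term recurrence in [l]. Dividing by [2^l (m+l)!/(m-l)!] and running
    the recurrence downwards from [l = m], where the quotient is [1], shows that
    the quotient is an odd integer: its coefficients are [2m+1] and the product
    [(m-l-1)(m+l+2)] of two numbers of opposite parity. Hence
    [X(l) = l + nu_2((i+2l)!) - nu_2(i!)] at index [i >= 0]. Write
    [2l = 2^n (2j+1)]. Comparing consecutive terms, [X(l)] is [2^n]-simple, and
    [nu_2((2^n N)!) = (2^n-1) N + nu_2(N!)] turns the output of a cycle into a
    translate of [X(j)] with [j < l]. *)

Require Import Defs.
From mathcomp Require Import all_boot all_order all_algebra.
From mathcomp Require Import zify ring.

Set Implicit Arguments.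
Unset Strict Implicit.
Unset Printing Implicit Defensive.

Import Order.TTheory GRing.Theory Num.Theory.
Local Open Scope ring_scope.

(** * Three-term recurrence in [l] *)

Definition summand (m k : nat) : nat :=
  (2 ^ k * 'C(2 * m - 2 * k, m - k) * 'C(m + k, m))%N.

Lemma central_bin_rec p :
  (p.+1 * 'C(2 * p.+1, p.+1) = 2 * (2 * p).+1 * 'C(2 * p, p))%N.
Proof.
have H1 : (p.+1 * 'C(2 * p.+1, p.+1) = (2 * p.+1) * 'C((2 * p).+1, p))%N.
  have -> : (2 * p.+1 = (2 * p).+2)%N by lia.
  by rewrite -mul_bin_diag.
have H2 : (p.+1 * 'C((2 * p).+1, p) = (2 * p).+1 * 'C(2 * p, p))%N.
  have := mul_bin_down (2 * p).+1 p.
  by have -> : ((2 * p).+1 - p = p.+1)%N by lia; move=> <-.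
nia.
Qed.

(** The hypergeometric term ratio, with [m = k.+1 + p] so that no truncated subtraction remains. *)
Lemma summand_rec p k :
  (k.+1 * (2 * p).+1 * summand (k.+1 + p) k.+1
   = p.+1 * (2 * k + p + 2) * summand (k.+1 + p) k)%N.
Proof.
rewrite /summand.
have -> : (2 * (k.+1 + p) - 2 * k.+1 = 2 * p)%N by lia.
have -> : (k.+1 + p - k.+1 = p)%N by lia.
have -> : (2 * (k.+1 + p) - 2 * k = 2 * p.+1)%N by lia.
have -> : (k.+1 + p - k = p.+1)%N by lia.
have Hc := central_bin_rec p.
have Hb : (k.+1 * 'C(k.+1 + p + k.+1, k.+1 + p)
           = (2 * k + p + 2) * 'C(k.+1 + p + k, k.+1 + p))%N.
  have := mul_bin_down (k.+1 + p + k).+1 (k.+1 + p).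
  have -> : ((k.+1 + p + k).+1 - (k.+1 + p) = k.+1)%N by lia.
  rewrite /= -addnS => <-; congr (_ * _)%N; lia.
rewrite expnS.
transitivity ((2 * (2 * p).+1 * 'C(2 * p, p)) * 2 ^ k
  * (k.+1 * 'C(k.+1 + p + k.+1, k.+1 + p)))%N; first by ring.
rewrite Hb -Hc; ring.
Qed.

(** The l-th derivative at 1 of the polynomial with coefficients [summand m k]. *)
Definition factsum (m l : nat) : int :=
  \sum_(k < m.+1) (summand m k * k ^_ l)%:Z.

Lemma ffactSZ (k l : nat) : (k ^_ l.+1)%:Z = (k%:Z - l%:Z) * (k ^_ l)%:Z.
Proof.
have [lk|kl] := leqP l k; first by rewrite ffactnSr PoszM subzn // mulrC.
by rewrite !ffact_small ?mulr0 //; lia.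
Qed.

(** Zeilberger-style telescoping: the k-th term of the difference of the two sides is [v k - u k],
    and the term ratio gives [u k.+1 = v k], with [u 0 = v m = 0] at the ends. *)
Lemma factsum_rec (m l : nat) :
  factsum m l.+2 = (2 * m%:Z + 1) * factsum m l.+1
                   - (m%:Z - l%:Z) * (m%:Z + l%:Z + 1) * factsum m l.
Proof.
pose u k : int := k%:Z * (2 * m%:Z - 2 * k%:Z + 1) * (summand m k)%:Z
                  * (k.-1 ^_ l)%:Z.
pose v k : int := (m%:Z - k%:Z) * (m%:Z + k%:Z + 1) * (summand m k)%:Z
                  * (k ^_ l)%:Z.
have uv : \sum_(k < m.+1) u k = \sum_(k < m.+1) v k.
  rewrite big_ord_recl big_ord_recr /=.
  have -> : u 0%N = 0 by rewrite /u !mul0r.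
  have -> : v m = 0 by rewrite /v subrr !mul0r.
  rewrite add0r addr0; apply: eq_bigr => k _.
  have := ltn_ord k; move: (nat_of_ord k) => {}k km.
  rewrite /u /v /bump /= add1n.
  have [p ->] : exists p, m = (k.+1 + p)%N by exists (m - k.+1)%N; lia.
  congr (_ * _).
  have := summand_rec p k.
  move: (summand _ k.+1) (summand _ k) => x y /(congr1 Posz).
  rewrite !PoszM => H.
  transitivity (k.+1%:Z * (2 * p).+1%:Z * x%:Z); last rewrite H.
    by congr (_ * _ * _); lia.
  by congr (_ * _ * _); lia.
apply/eqP; rewrite -subr_eq0 /factsum !mulr_sumr -!sumrB.
have -> : \sum_(i < m.+1) ((summand m i * i ^_ l.+2)%:Z
   - ((2 * m%:Z + 1) * (summand m i * i ^_ l.+1)%:Z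
      - (m%:Z - l%:Z) * (m%:Z + l%:Z + 1) * (summand m i * i ^_ l)%:Z))
   = \sum_(i < m.+1) (v i - u i).
  apply: eq_bigr => [[k ?] _] /=; rewrite /u /v.
  move: (summand m k) => x; rewrite !(PoszM x).
  have Hk : k%:Z * (k.-1 ^_ l)%:Z = (k ^_ l.+1)%:Z.
    by case: (k) => [|k']; rewrite ?mul0r ?ffact0n // ffactnS PoszM.
  transitivity ((m%:Z - k%:Z) * (m%:Z + k%:Z + 1) * x%:Z * (k ^_ l)%:Z
    - (k%:Z * (k.-1 ^_ l)%:Z) * (2 * m%:Z - 2 * k%:Z + 1) * x%:Z); last by ring.
  rewrite Hk !ffactSZ -[l.+1]addn1 PoszD; ring.
by rewrite sumrB uv subrr.
Qed.

Lemma factsum_small m l : (m < l)%N -> factsum m l = 0.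
Proof.
move=> ml; rewrite /factsum big1 // => k _.
by rewrite ffact_small ?muln0 //; have := ltn_ord k; lia.
Qed.

Lemma factsum_diag m : m`!%:Z * factsum m m = 2 ^+ m * (m + m)`!%:Z.
Proof.
rewrite /factsum big_ord_recr /= big1 => [|k _]; last first.
  by rewrite ffact_small ?muln0 // ltn_ord.
rewrite add0r /summand !subnn bin0 muln1 ffactnn.
have H : ('C(m + m, m) * (m`! * m`!) = (m + m)`!)%N.
  by have := @bin_fact (m + m) m (leq_addr _ _); rewrite addnK.
have -> : (2 : int) ^+ m = (2 ^ m)%N%:Z by rewrite -natrX natz.
by rewrite -H -!PoszM; congr Posz; ring.
Qed.

(** * Solving the recurrence downwards from [l = m] *)

(* [quot m d] is [A_{l,m} / (2^l (m+l)!/(m-l)!)] at [l = m - d]. *)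
Fixpoint quot (m d : nat) : int :=
  match d with
  | 0 => 1
  | 1 => 2 * m%:Z + 1
  | (d'.+1 as d1).+1 => (2 * m%:Z + 1) * quot m d1
                        - (d1%:Z * (2 * m%:Z - d'%:Z)) * quot m d'
  end.

Lemma quotSS m d : quot m d.+2 = (2 * m%:Z + 1) * quot m d.+1
                        - (d.+1%:Z * (2 * m%:Z - d%:Z)) * quot m d.
Proof. by []. Qed.

Lemma quot_odd m d : odd `|quot m d|%N.
Proof.
suff [] : odd `|quot m d|%N /\ odd `|quot m d.+1|%N by [].
elim: d => [|d [IH1 IH2]]; first by split => //=; lia.
split=> //; rewrite quotSS.
have [k ->] : exists k : int, quot m d.+1 = 2 * k + 1.
  by exists (quot m d.+1 %/ 2)%Z; lia.
(* The two factors have opposite parity: [d.+1] is halved for odd [d], the other one for even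
   [d]. *)
have [j ->] : exists j : int, d.+1%:Z * (2 * m%:Z - d%:Z) = 2 * j.
  have [/eqP|/eqP] : odd d == true \/ odd d == false by case: (odd d); [left|right].
    move=> od; exists (d.+1./2%:Z * (2 * m%:Z - d%:Z)).
    by rewrite mulrA; congr (_ * _); lia.
  move=> od; exists (d.+1%:Z * (m%:Z - d./2%:Z)).
  by rewrite mulrCA; congr (_ * _); lia.
have -> : (2 * m%:Z + 1) * (2 * k + 1) - 2 * j * quot m d
  = 2 * ((2 * m%:Z + 1) * k + m%:Z - j * quot m d) + 1 by ring.
by move: (_ - _) => z; lia.
Qed.

(** Induction over pairs of consecutive [d], the recurrence having order two; factorials are
    multiplied across to stay in the integers. *)
Lemma factsum_quot m d l : (l + d = m)%N ->
  m`!%:Z * d`!%:Z * factsum m l = 2 ^+ m * (m + l)`!%:Z * quot m d.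
Proof.
suff [] : (forall l, (l + d = m)%N ->
    m`!%:Z * d`!%:Z * factsum m l = 2 ^+ m * (m + l)`!%:Z * quot m d) /\
  (forall l, (l + d.+1 = m)%N ->
    m`!%:Z * d.+1`!%:Z * factsum m l = 2 ^+ m * (m + l)`!%:Z * quot m d.+1).
  by move=> H _; apply: H.
elim: d {l} => [|d [IH1 IH2]]; split=> //.
- by move=> l; rewrite addn0 => ->; rewrite fact0 !mulr1 factsum_diag.
- move=> l lm; have := factsum_rec m l.
  (* Here [l.+2 = m.+1], so the left-hand side of the recurrence vanishes. *)
  rewrite factsum_small; last by lia.
  have -> : l.+1 = m by lia.
  have -> : m%:Z - l%:Z = 1 by lia.
  have -> : m%:Z + l%:Z + 1 = (m + l).+1%:Z by lia.
  have := factsum_diag m.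
  have -> : (m + m = (m + l).+1)%N by lia.
  rewrite [(m + l).+1`!]factS PoszM /= => D R.
  have nz : (m + l).+1%:Z != 0 by [].
  apply: (mulfI nz).
  transitivity (m`!%:Z * ((2 * m%:Z + 1) * factsum m m)).
    have -> : (2 * m%:Z + 1) * factsum m m = 1 * (m + l).+1%:Z * factsum m l.
      by apply/eqP; rewrite -subr_eq0 -R.
    by rewrite (_ : 1`!%:Z = 1) //; ring.
  transitivity ((2 * m%:Z + 1) * (m`!%:Z * factsum m m)); first by ring.
  rewrite D; ring.
- move=> l lm; have R := factsum_rec m l.
  have /IH1 E1 : (l.+2 + d = m)%N by lia.
  have /IH2 E2 : (l.+1 + d.+1 = m)%N by lia.
  have nz : (m + l).+1%:Z != 0 by [].
  (* Solving the recurrence for [factsum m l] would divide by [m + l + 1]; both sides are multiplied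
     by it instead. *)
  apply: (mulfI nz).
  rewrite quotSS.
  have f1 : (m + l.+1)`!%:Z = (m + l).+1%:Z * (m + l)`!%:Z.
    by rewrite addnS factS PoszM.
  have f2 : (m + l.+2)`!%:Z = (m + l).+2%:Z * ((m + l).+1%:Z * (m + l)`!%:Z).
    by rewrite !addnS !factS !PoszM.
  have g1 : d.+1`!%:Z = d.+1%:Z * d`!%:Z by rewrite factS PoszM.
  have g2 : d.+2`!%:Z = d.+2%:Z * d.+1`!%:Z by rewrite factS PoszM.
  transitivity ((2 * m%:Z + 1) * (m`!%:Z * d.+1`!%:Z * factsum m l.+1)
                - d.+1%:Z * (m`!%:Z * d`!%:Z * factsum m l.+2)).
    rewrite R g2 g1.
    have -> : m%:Z - l%:Z = d.+2%:Z by lia.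
    have -> : m%:Z + l%:Z + 1 = (m + l).+1%:Z by lia.
    ring.
  rewrite E1 E2 f1 f2.
  have -> : 2 * m%:Z - d%:Z = (m + l).+2%:Z by lia.
  ring.
Qed.

(** * Factorization of the coefficients *)

Lemma A_factsum l m : A l m = m`!%:R / 2 ^+ (m - l) * (factsum m l)%:~R.
Proof.
rewrite /A natrM -!mulrA mulrCA; congr (_ * _); rewrite mulrCA; congr (_ * _).
rewrite /factsum rmorph_sum /= mulr_sumr.
rewrite -(big_mkord xpredT (fun k => (Posz (summand m k * k ^_ l))%:~R)).
have [lm|ml] := leqP l m.+1; last first.
  rewrite [LHS]big_geq; last by lia.
  rewrite big_nat big1 // => k /andP[_ km].
  by rewrite ffact_small ?muln0 //; lia.
rewrite [RHS](big_cat_nat (leq0n l) lm) //=.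
rewrite [X in _ = X + _]big_nat [X in _ = X + _]big1; last first.
  by move=> k /andP[_ kl]; rewrite ffact_small ?muln0.
rewrite add0r; apply: eq_bigr => k _.
rewrite -natrM; congr (_%:R); rewrite -bin_ffact /summand; ring.
Qed.

Lemma ffact_top_fact l i :
  ((l + i + l) ^_ (l + l) * i`! = (l + i + l)`!)%N.
Proof.
have E : (l + i + l - (l + l) = i)%N by lia.
by rewrite -[in i`!]E ffact_fact //; lia.
Qed.

(** With [m = l + i], the falling factorial is (m+l)!/(m-l)!, and 2^m / 2^(m-l) leaves 2^l. *)
Lemma A_eq_quot l i :
  A l (l + i) = ((2 ^ l * (l + i + l) ^_ (l + l))%N%:Z * quot (l + i) i)%:~R.
Proof.
have H := @factsum_quot (l + i) i l erefl.
have iF : (i`!%:R : rat) != 0 by rewrite pnatr_eq0 -lt0n fact_gt0.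
apply: (mulfI iF); rewrite A_factsum addKn.
have ff := ffact_top_fact l i.
have tn : (2 ^+ i : rat) != 0 by rewrite expf_neq0.
apply: (mulfI tn).
transitivity ((((l + i)`!%:Z * i`!%:Z * factsum (l + i) l)%:~R) : rat).
  by rewrite !rmorphM /=; field.
rewrite H -ff !rmorphM /= !rmorphXn /= exprD -!pmulrn natrX.
ring.
Qed.

(** * Valuations of factorials and the closed form of [X l] *)

Lemma nu2_nat (n : nat) : nu2 n%:R = (logn 2 n)%:Z.
Proof. by rewrite /nu2 (pmulrn 1 n) numq_int denq_int logn1 subr0. Qed.

Definition nu2fact (n : nat) : int := (logn 2 n`!)%:Z.

Lemma nu2factS n : nu2fact n.+1 = (logn 2 n.+1)%:Z + nu2fact n.
Proof. by rewrite /nu2fact factS lognM ?fact_gt0. Qed.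

Lemma X_nu2fact l i : X l i = l%:Z + nu2fact (i + 2 * l) - nu2fact i.
Proof.
rewrite /X A_eq_quot /nu2 numq_int denq_int logn1 subr0 abszM /=.
have ff := ffact_top_fact l i.
have o := quot_odd (l + i) i.
have fp : (0 < (l + i + l) ^_ (l + l))%N by rewrite ffact_gt0; lia.
have qp := odd_gt0 o.
rewrite lognM ?muln_gt0 ?expn_gt0 ?fp // lognM ?expn_gt0 // pfactorK //.
have -> : logn 2 `|quot (l + i) i| = 0%N.
  by rewrite lognE /= dvdn2 o /= andbF.
rewrite /nu2fact (_ : (i + 2 * l = l + i + l)%N); last by lia.
by rewrite -ff lognM ?fact_gt0 //; lia.
Qed.

Lemma nu2fact_double n : nu2fact (2 * n) = n%:Z + nu2fact n.
Proof.
elim: n => [|n IH]; first by rewrite muln0.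
have -> : (2 * n.+1 = (2 * n).+2)%N by lia.
rewrite !nu2factS IH.
have -> : logn 2 (2 * n).+1 = 0%N by rewrite lognE dvdn2 /= mul2n odd_double.
have -> : ((2 * n).+2 = 2 * n.+1)%N by lia.
by rewrite lognM // logn_prime //=; lia.
Qed.

Lemma nu2fact_mul2X n N :
  nu2fact (2 ^ n * N) = ((2 ^ n - 1) * N)%N%:Z + nu2fact N.
Proof.
elim: n => [|n IH]; first by rewrite expn0 subnn mul0n mul1n.
rewrite expnS -mulnA nu2fact_double IH addrA; congr (_ + _).
have : (0 < 2 ^ n)%N by rewrite expn_gt0.
move: (2 ^ n)%N => p p0; rewrite -PoszD; congr Posz; nia.
Qed.

Lemma X_succ l i :
  X l i.+1 = X l i + (logn 2 (i + 2 * l).+1)%:Z - (logn 2 i.+1)%:Z.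
Proof. rewrite !X_nu2fact addSn !nu2factS; ring. Qed.

(** * Simplicity of [X l] *)

Lemma two_mul_decomp l : (0 < l)%N ->
  exists n j, [/\ (0 < n)%N, (j < l)%N & (2 * l = 2 ^ n * (2 * j).+1)%N].
Proof.
move=> l0; have [q cq E] := pfactor_coprime (isT : prime 2) l0.
move: cq; rewrite coprime2n => oq.
exists (logn 2 l).+1, q./2.
have : (0 < 2 ^ logn 2 l)%N by rewrite expn_gt0.
move: E; rewrite expnS; move: (2 ^ _)%N => p E p0.
split=> //; last by rewrite {1}E; nia.
nia.
Qed.

(** If [m = r * 2 ^ a] with [r] odd and [a < n], the added term only changes [r] by an even
    number. *)
Lemma logn2_addr n q m : ~~ (2 ^ n %| m)%N ->
  logn 2 (m + 2 ^ n * q) = logn 2 m.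
Proof.
move=> nd; have m0 : (0 < m)%N by case: m nd; rewrite ?dvdn0.
move: nd; rewrite pfactor_dvdn // -ltnNge => an.
have [r] := pfactor_coprime (isT : prime 2) m0.
rewrite coprime2n => oddr E; move: an E; set a := logn 2 m => an E.
have -> : (m + 2 ^ n * q = (r + 2 * (2 ^ (n - a).-1 * q)) * 2 ^ a)%N.
  rewrite mulnDl -E mulnA -expnS prednK ?subn_gt0 //; congr (_ + _)%N.
  by rewrite mulnAC -expnD subnK // ltnW.
rewrite logn_Gauss ?pfactorK // coprime2n oddD oddM addbF; exact: oddr.
Qed.

(** Inside a block [i.+1] is not divisible by [2 ^ n], so shifting it by [2 * l] keeps its valuation
    and the increment in [X_succ] is zero. *)
Lemma X_block_constant l n q : (2 * l = 2 ^ n * q)%N ->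
  block_constant (2 ^ n)%N (X l).
Proof.
move=> E t; elim=> [|i IH] lt_i; first by rewrite addn0.
rewrite addnS X_succ IH; last exact: ltnW.
rewrite -addSn E logn2_addr; first by rewrite addrK.
by rewrite -addnS dvdn_addr ?dvdn_mulr // gtnNdvd.
Qed.

Lemma X_simple l n j : (0 < n)%N -> (2 * l = 2 ^ n * (2 * j).+1)%N ->
  simple (2 ^ n)%N (X l).
Proof.
move=> n0 E; split; first by rewrite -{1}(expn1 2) leq_exp2l.
  exact: X_block_constant E.
move=> s bs; rewrite leqNgt; apply/negP => lt_s.
have p0 : (0 < 2 ^ n)%N by rewrite expn_gt0.
(* A longer first block would contain the step from index [2 ^ n - 1] to [2 ^ n], but the increment
   there is the valuation of [2 * j.+1], which is positive. *)
have := bs 0%N _ lt_s; rewrite -(bs 0%N (2 ^ n).-1); last by rewrite prednK // ltnW.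
rewrite muln0 !add0n -[X in Defs.X l X = _](prednK p0) X_succ E prednK //.
rewrite -addSn prednK // -mulnS (_ : (2 * j).+2 = 2 * j.+1)%N; last by lia.
by rewrite !lognM ?muln_gt0 // pfactorK // logn_prime //=; lia.
Qed.

(** * Effect of one cycle *)

Lemma iterT n a i : iter n T a i = a (2 ^ n * i)%N.
Proof.
elim: n a i => [|n IH] a i; first by rewrite mul1n.
by rewrite iterS /T IH expnS mulnCA mulnA.
Qed.

Lemma output_X l n j : (2 * l = 2 ^ n * (2 * j).+1)%N ->
  is_translate (output n (X l)) (X j).
Proof.
move=> E; exists (l%:Z + ((2 ^ n - 1) * (2 * j).+1)%N%:Z - j%:Z).
(* Subtracting [c] turns k! into (k+1)!, hence the index [k.+1]. [F] undoes this shift; at index 0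
   it repeats a term, which is right because [X j 1 = X j 0], as [2 * j + 1] is odd. *)
suff H k : iter n T (X l) k - c k
           = X j k.+1 + (l%:Z + ((2 ^ n - 1) * (2 * j).+1)%N%:Z - j%:Z).
  case=> [|i]; rewrite /output /F H //=; congr (_ + _).
  by rewrite X_succ logn1 add0n lognE dvdn2 /= mul2n odd_double /= subr0 addr0.
rewrite iterT /c nu2_nat !X_nu2fact E -mulnDr !nu2fact_mul2X mulnDr PoszD.
rewrite addSnnS nu2factS; ring.
Qed.

Lemma output_translate n a b : is_translate a b ->
  is_translate (output n a) (output n b).
Proof.
by move=> [t H]; exists t => i; rewrite /output /F !iterT H addrAC.
Qed.

Lemma is_translate_trans a b d :
  is_translate a b -> is_translate b d -> is_translate a d.
Proof. by move=> [t H] [u K]; exists (u + t) => i; rewrite H K addrA. Qed.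

Lemma simple_translate s a b : is_translate a b -> simple s b -> simple s a.
Proof.
move=> [t H] [s2 bb mx]; split=> // [u i lt_i|s' bs'].
  by rewrite !H bb.
by apply: mx => u i lt_i; apply: (addIr t); rewrite -!H bs'.
Qed.

Lemma X_translate_cycle l a : (0 < l)%N -> is_translate a (X l) ->
  exists n j, [/\ simple (2 ^ n)%N a, (j < l)%N
                & is_translate (output n a) (X j)].
Proof.
move=> l0 tr; have [n [j [n0 jl E]]] := two_mul_decomp l0.
exists n, j; split=> //; first exact: simple_translate tr (X_simple n0 E).
exact: is_translate_trans (output_translate n tr) (output_X E).
Qed.

Lemma X0_translate_constant w : is_translate w (X 0) -> constant_seq w.
Proof.
by move=> [t H]; exists t => i; rewrite H X_nu2fact muln0 addn0 add0r subrr add0r.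
Qed.

Lemma X_translate_output l n a : (0 < l)%N -> is_translate a (X l) ->
  simple (2 ^ n)%N a -> exists2 j, (j < l)%N & is_translate (output n a) (X j).
Proof.
move=> l0 tr sn; have [n' [j [sn' jl tj]]] := X_translate_cycle l0 tr.
have /(@expnI 2 isT) -> := simple_uniq sn sn'.
by exists j.
Qed.

(** * Termination *)

Lemma is_translate_refl a : is_translate a a.
Proof. by exists 0 => i; rewrite addr0. Qed.

Lemma algo_cycle_terminates l k a w j :
  algo_cycle l k a w -> is_translate w (X j) -> terminates l.
Proof.
have [N] := ubnP j; elim: N => // N IH in k a w j *; rewrite ltnS => jN h tr.
have [j0|jpos] := posnP j.
  by exists k, a, w; split=> //; apply: X0_translate_constant; rewrite -j0.
have [n [j' [sn j'j tr']]] := X_translate_cycle jpos tr.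
(* A constant sequence is block constant for every length, so it is never simple. *)
have nc : ~ constant_seq w.
  case=> t ct; case: sn => _ _ /(_ (2 ^ n).+1).
  by rewrite ltnn => H; suff /H : block_constant (2 ^ n).+1 w by [];
    move=> ? ? _; rewrite !ct.
apply: (IH _ _ _ _ _ (algo_cycle_next h nc sn) tr'); exact: leq_trans jN.
Qed.

Theorem theorem5p3 (l : nat) (hl : (1 <= l)%N) :
  terminates l /\
  forall (k : nat) (a w : sequence), algo_cycle l k a w ->
    exists j : nat, (j < l)%N /\ is_translate w (X j).
Proof.
split.
  have [n [j [sn _ tr]]] := X_translate_cycle hl (is_translate_refl (X l)).
  exact: algo_cycle_terminates (algo_cycle_first sn) tr.
move=> k a w; elim=> {k a w} [n sn|k a w n _ [j [jl tr]] nc sn].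
  have [j jl tr] := X_translate_output hl (is_translate_refl (X l)) sn.
  by exists j.
(* A translate of [X 0] is constant, and then no further cycle is run. *)
have [j0|jpos] := posnP j.
  by case: nc; apply: X0_translate_constant; rewrite -j0.
have [j' j'j tr'] := X_translate_output jpos tr sn.
by exists j'; split=> //; apply: ltn_trans jl.
Qed.
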